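(* For every integer $n\ge0$, $$(x)_{n,q,t}=\sum_{k=0}^n s_{q,t}[n,k]\,x^k\qquad\text{and}\qquad x^n=\sum_{k=0}^nS_{q,t}[n,k]\,(x)_{k,q,t},$$ where $(x)_{k,q,t}=\prod_{j=0}^{k-1}(x-[j]_{q,t})$.
   Context: $q,t,x$ are indeterminates. $[0]_{q,t}=0$; for even $k\ge2$, $[k]_{q,t}=(1+q^2+\dots+q^{k-2})\,t$; for odd $k\ge1$, $[k]_{q,t}=q^{k-1}+(1+q^2+\dots+q^{k-3})\,t$. RG-words: $\mathcal R(n,k)$ is the set of words $w=w_1\cdots w_n$ of positive integers with $w_1=1$, $w_i\le\max(w_1,\dots,w_{i-1})+1$, $\max_iw_i=k$; $\mathcal A(n,k)$ is the subset in which each even letter occurs exactly once. With $m_i=\max(w_1,\dots,w_i)$, $A(w)=\sum_{i\ge2}A_i(w)$ where $A_i(w)=w_i-1$ if $m_{i-1}\ge w_i$ and $0$ otherwise, and $B(w)=\#\{i\ge2:m_{i-1}>w_i\}$. For $n\ge1$, $1\le k\le n$: $S_{q,t}[n,k]=\sum_{w\in\mathcal A(n,k)}q^{A(w)}t^{B(w)}$; $S_{q,t}[n,0]=\delta_{n,0}$; $S_{q,t}[n,k]=0$ for $k>n$. Rooks: the staircase board of length $n$ has squares $(i,j)$, $i,j\ge1$, $i+j\le n$ (row $i$ from top); $(i,j)$ has $n-i-j$ squares below it and is shaded if $n-i-j$ is even. $\mathcal{AR}(n,r)$ is the set of placements of $r$ rooks on shaded squares, no two in the same column; $\mathrm{below}(T)$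 is the total number of squares below rooks, $\mathrm{nrow}(T)$ the number of rooks not in row $1$. For $n\ge1$, $0\le k\le n$: $s_{q,t}[n,k]=(-1)^{n-k}\sum_{T\in\mathcal{AR}(n,n-k)}q^{\mathrm{below}(T)}t^{\mathrm{nrow}(T)}$; $s_{q,t}[0,0]=1$; $s_{q,t}[n,k]=0$ for $k>n$. *)

(* Defs.v *)
From HB Require Import structures.
From mathcomp Require Import all_boot all_order all_algebra.
From mathcomp Require Import mpoly.

Set Implicit Arguments.
Unset Strict Implicit.
Unset Printing Implicit Defensive.

Import GRing.Theory.
Local Open Scope ring_scope.

(* The indeterminates q, t, x of the polynomial ring Z[q, t, x]. *)
Definition Xq : {mpoly int[3]} := 'X_(@Ordinal 3 0 isT).
Definition Xt : {mpoly int[3]} := 'X_(@Ordinal 3 1 isT).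
Definition Xx : {mpoly int[3]} := 'X_(@Ordinal 3 2 isT).

(* In both parities the parenthesised sum 1 + q^2 + ... has k./2 terms; in
   particular it is empty for k = 0 and k = 1. *)
Definition qt_bracket (R : comNzRingType) (q t : R) (k : nat) : R :=
  if odd k then q ^+ k.-1 + (\sum_(i < k./2) q ^+ (2 * i)) * t
  else (\sum_(i < k./2) q ^+ (2 * i)) * t.

Definition qt_falling (R : comNzRingType) (q t x : R) (n : nat) : R :=
  \prod_(j < n) (x - qt_bracket q t j).

Local Open Scope nat_scope.

(* Positions in a word are counted from 1: w_i is [letter w i]. *)
Definition letter (w : seq nat) (i : nat) : nat := nth 0 w i.-1.

Definition prefix_max (w : seq nat) (i : nat) : nat := \max_(a <- take i w) a.

Definition is_RG_word (n k : nat) (w : seq nat) : bool :=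
  [&& size w == n,
      all (leq 1) w,
      letter w 1 == 1,
      all (fun i => letter w i <= prefix_max w i.-1 + 1) (iota 2 n.-1)
    & prefix_max w n == k].

Definition even_letters_once (w : seq nat) : bool :=
  all (fun a => ~~ odd a ==> (count_mem a w == 1)) w.

(* The letters of a word of maximum k are at most k, so nothing is lost by
   taking them in 'I_k.+1 = {0, ..., k}. *)
Definition nat_word (n k : nat) (w : n.-tuple 'I_k.+1) : seq nat :=
  [seq val a | a <- w].

Definition RG_words (n k : nat) : {set n.-tuple 'I_k.+1} :=
  [set w | is_RG_word n k (nat_word w)].

Definition allowable_RG_words (n k : nat) : {set n.-tuple 'I_k.+1} :=
  [set w in RG_words n k | even_letters_once (nat_word w)].

Definition statA (w : seq nat) : nat :=
  \sum_(2 <= i < (size w).+1)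
    (if letter w i <= prefix_max w i.-1 then letter w i - 1 else 0).

Definition statB (w : seq nat) : nat :=
  count (fun i => letter w i < prefix_max w i.-1) (iota 2 (size w).-1).

(* A pair s : 'I_n * 'I_n stands for the square in row s.1 (from the top) and
   column s.2, both counted from 1; i + j <= n and i, j >= 1 force i, j < n. *)
Definition in_staircase (n : nat) (s : 'I_n * 'I_n) : bool :=
  [&& 1 <= s.1, 1 <= s.2 & s.1 + s.2 <= n].

Definition squares_below (n : nat) (s : 'I_n * 'I_n) : nat := n - s.1 - s.2.

Definition shaded (n : nat) (s : 'I_n * 'I_n) : bool :=
  in_staircase s && ~~ odd (squares_below s).

Definition rook_placements (n r : nat) : {set {set 'I_n * 'I_n}} :=
  [set T : {set 'I_n * 'I_n} |
    [&& #|T| == r,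
        [forall s in T, shaded s]
      & [forall s1 in T, forall s2 in T, (s1 != s2) ==> (s1.2 != s2.2)]]].

Definition below (n : nat) (T : {set 'I_n * 'I_n}) : nat :=
  \sum_(s in T) squares_below s.

Definition nrow (n : nat) (T : {set 'I_n * 'I_n}) : nat :=
  #|[set s in T | s.1 != 1 :> nat]|.

Local Open Scope ring_scope.

Definition qt_stirling2 (R : comNzRingType) (q t : R) (n k : nat) : R :=
  if k == 0%N then (n == 0%N)%:R
  else if (n < k)%N then 0
  else \sum_(w in allowable_RG_words n k)
         q ^+ statA (nat_word w) * t ^+ statB (nat_word w).

Definition qt_stirling1 (R : comNzRingType) (q t : R) (n k : nat) : R :=
  if (n < k)%N then 0
  else if n == 0%N then 1
  else (-1) ^+ (n - k) *
       \sum_(T in rook_placements n (n - k)) q ^+ below T * t ^+ nrow T.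

(* Main.v *)
Require Import Defs.
From mathcomp Require Import all_boot all_order all_algebra.
From mathcomp Require Import mpoly.
From mathcomp Require Import zify ring.

Import GRing.Theory.
Local Open Scope ring_scope.

(** The squares of column [j] of the staircase have total weight
    [[n - j]_{q,t}], so choosing in each column either [x] or minus one of its
    squares expands the product [(x)_{n,q,t}] over rook placements.

    Deleting the last letter of an allowable word of maximum [k + 1] leaves
    either a word of maximum [k] (the letter was [k + 1]) or a word of maximum
    [k + 1] followed by an arbitrary odd letter, since all even letters are
    already used; the odd letters contribute [[k + 1]_{q,t}].  This recurrence
    and [x (x)_k = (x)_{k+1} + [k]_{q,t} (x)_k] give the second identity. *)

Set Implicit Arguments.
Unset Strict Implicit.
Unset Printing Implicit Defensive.

(** * The bracket as a sum over even exponents *)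

Lemma sum_ord_even (R : nmodType) (F : nat -> R) (m : nat) :
  \sum_(i < m | ~~ odd i) F i = \sum_(i < uphalf m) F (2 * i)%N.
Proof.
elim: m => [|m IH]; first by rewrite !big_ord0.
rewrite big_mkcond big_ord_recr -big_mkcond /= {}IH uphalf_half.
case: ifPn => om; last first.
  by rewrite addr0 (negbNE om).
rewrite (negbTE om) add0n big_ord_recr /=.
by congr (_ + F _); rewrite mul2n even_halfK.
Qed.

(* Both the squares of a column of [m] squares and the letters repeated under
   a maximum [m] are counted by this sum over even [i]: [i] is the number of
   squares below, resp. the letter minus one. *)
Lemma qt_bracketE (R : comNzRingType) (q t : R) (m : nat) :
  qt_bracket q t m = \sum_(i < m | ~~ odd i) q ^+ i * t ^+ (i.+1 != m).
Proof.
rewrite /qt_bracket; case: m => [|m]; first by rewrite !big_ord0 mul0r.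
(* The top index [m] is split off: it alone carries no factor [t], and it survives the parity filter
   exactly when [m.+1] is odd. *)
rewrite [RHS]big_mkcond big_ord_recr -big_mkcond /= eqxx expr0 mulr1.
rewrite (eq_bigr (fun i : 'I_m => q ^+ i * t)); last first.
  by move=> i _; rewrite eqSS (ltn_eqF (ltn_ord i)).
rewrite (sum_ord_even (fun i => q ^+ i * t)) mulr_suml addrC uphalf_half.
by case: (boolP (odd m)) => om //=; rewrite add0r.
Qed.

(** * Rook placements *)

Section ColumnPlacements.
Variables (R : comNzRingType) (I J : finType).
Implicit Types (T : {set I * J}) (f : {ffun J -> option I}).

Definition column_free T :=
  [forall s1 in T, forall s2 in T, (s1 != s2) ==> (s1.2 != s2.2)].

(** A column-free placement amounts to a partial function from columns to rows, with [None] for an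
    empty column; [column_choice] is the inverse passage. *)
Definition placement_of f : {set I * J} := [set s | f s.2 == Some s.1].

Definition column_choice T : {ffun J -> option I} :=
  [ffun j => [pick i | (i, j) \in T]].

Lemma column_choiceK T : column_free T -> placement_of (column_choice T) = T.
Proof.
move=> Tfree; apply/setP=> -[i j]; rewrite inE ffunE /=.
case: pickP => [i' i'T|noT]; last by rewrite noT.
apply/eqP/idP => [[<-] //|iT]; congr Some; apply/eqP/negPn/negP => ne.
have /forall_inP/(_ (i, j) iT)/implyP := forall_inP Tfree (i', j) i'T.
rewrite eqxx /= => /(_ _)/notF; apply.
by apply: contraNneq ne => -[->].
Qed.

Lemma placement_of_free f : column_free (placement_of f).
Proof.
apply/forallP=> -[i j]; apply/implyP; rewrite inE /= => /eqP fj.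
apply/forallP=> -[i' j']; apply/implyP; rewrite inE /= => /eqP fj'.
by apply/implyP; apply: contraNneq => /= ejj; move: fj'; rewrite -ejj fj => -[->].
Qed.

Lemma placement_ofK : cancel placement_of column_choice.
Proof.
move=> f; apply/ffunP=> j; rewrite ffunE.
case: pickP => [i|nof]; first by rewrite inE => /eqP.
by case fj: (f j) => [i|//]; have := nof i; rewrite inE /= fj eqxx.
Qed.

Lemma column_free_card T : column_free T -> (#|T| <= #|J|)%N.
Proof.
move=> Tfree; rewrite -(@card_in_imset _ _ snd) ?max_card // => s1 s2 s1T s2T.
apply: contra_eq.
by have /forall_inP/(_ _ s2T)/implyP := forall_inP Tfree _ s1T.
Qed.

Lemma big_placement_of (S : Type) (idx : S) (op : Monoid.com_law idx)
    (f : {ffun J -> option I}) (G : I * J -> S) :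
  \big[op/idx]_(s in placement_of f) G s =
    \big[op/idx]_(j | f j != None) (if f j is Some i then G (i, j) else idx).
Proof.
rewrite (partition_big snd (fun j => f j != None)) /=; last first.
  by move=> s; rewrite inE => /eqP->.
apply: eq_bigr => j; case fj: (f j) => [i|//] _.
rewrite (big_pred1 (i, j)) // => -[i' j'] /=; rewrite inE /= xpair_eqE.
case: (j' =P j) => [->|]; rewrite ?andbF ?andbT // fj.
by rewrite -[RHS](inj_eq Some_inj) eq_sym.
Qed.

(** Distributivity turns the product into a sum over all [f : {ffun J -> option I}], where [None]
    selects [x]; these functions are then exchanged for column-free sets. *)
Lemma prod_columns (x : R) (g : I * J -> R) :
  \prod_j (x + \sum_i g (i, j)) =
  \sum_(T | column_free T) x ^+ (#|J| - #|T|) * \prod_(s in T) g s.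
Proof.
pose F j o := if o is Some i then g (i, j) else x.
have optE j : x + \sum_i g (i, j) = \sum_o F j o.
  rewrite (bigD1 None) //=; congr (_ + _).
  rewrite (reindex_omap Some id) /=; last by case.
  by apply: eq_bigl => i; rewrite eqxx.
rewrite (eq_bigr _ (fun j _ => optE j)) bigA_distr_bigA /=.
rewrite (reindex_onto placement_of column_choice column_choiceK) /=.
apply: eq_big => [f|f _]; first by rewrite placement_of_free placement_ofK eqxx.
rewrite (bigID (fun j => f j == None)) /=; congr (_ * _).
  rewrite (eq_bigr (fun=> x)); last by move=> j /eqP ->.
  rewrite prodr_const; congr (_ ^+ _).
  have -> : #|placement_of f| = #|predC (fun j => f j == None)|.
    rewrite -!sum1_card (big_placement_of addn f (fun=> 1%N)).
    by apply: eq_bigr => j; case: (f j).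
  by rewrite -(cardC (fun j => f j == None)) addnK.
by rewrite big_placement_of; apply: eq_bigr => j; case: (f j).
Qed.

End ColumnPlacements.

(** For [j > 0], reindex by the number [b] of squares below: the row is [n - j - b], and it is row 1
    exactly when [b.+1 = n - j], as in [qt_bracketE]. Column 0 exists only in the encoding and has
    no squares. *)
Lemma column_weight (R : comNzRingType) (q t : R) (n : nat) (j : 'I_n) :
  \sum_(i < n | shaded (i, j)) q ^+ squares_below (i, j) * t ^+ (i != 1%N :> nat)
    = qt_bracket q t (if j == 0 :> nat then 0 else n - j)%N.
Proof.
case: (posnP j) => [j0|j_gt0].
  rewrite big_pred0 /qt_bracket /= ?big_ord0 ?mul0r // => i.
  by rewrite /shaded /in_staircase /= j0 andbF.
rewrite qt_bracketE.
have lt_in (b : 'I_(n - j)) : (n - j - b < n)%N by move: (ltn_ord b); lia.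
pose h (b : 'I_(n - j)) : 'I_n := Ordinal (lt_in b).
rewrite (reindex_omap h (fun i : 'I_n => insub (n - j - i)%N)) /=; last first.
  move=> i /andP[/and3P[/= i0 _ ij] _].
  rewrite insubT /=; first by lia.
  by move=> lt_i; congr Some; apply: val_inj => /=; lia.
apply: eq_big => [b|b _].
  have -> : insub (n - j - (n - j - b))%N = Some b.
    by rewrite (_ : (_ - (_ - b))%N = b) ?valK //; move: (ltn_ord b); lia.
  rewrite eqxx andbT /shaded /in_staircase /squares_below /=.
  move: (ltn_ord b); lia.
rewrite /squares_below /=; congr (q ^+ _ * t ^+ _); move: (ltn_ord b); first lia.
by move=> ?; congr (nat_of_bool (~~ _)); lia.
Qed.

Lemma qt_falling_stirling1 (R : comNzRingType) (q t x : R) (n : nat) :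
  qt_falling q t x n = \sum_(0 <= k < n.+1) qt_stirling1 q t n k * x ^+ k.
Proof.
case: n => [|n].
  by rewrite /qt_falling big_ord0 big_nat1 /qt_stirling1 /= mul1r.
set N := n.+1.
(* The sign is put into the weight and unshaded squares weigh 0, so that [prod_columns] applies to
   the whole grid. *)
pose g (s : 'I_N * 'I_N) : R :=
  if shaded s then - (q ^+ squares_below s * t ^+ (s.1 != 1%N :> nat)) else 0.
have -> : qt_falling q t x N = \prod_j (x + \sum_i g (i, j)).
  (* The empty column 0 supplies the factor for [j = 0], and column [N - j] the factor for [j > 0];
     hence the reversal of the remaining indices. *)
  rewrite /qt_falling big_ord_recl [RHS]big_ord_recl (reindex_inj rev_ord_inj) /=.
  congr (_ * _); last apply: eq_bigr => j _.
    by congr (_ + _); rewrite -big_mkcond /= sumrN column_weight.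
  rewrite -big_mkcond /= sumrN column_weight /=; congr (_ - qt_bracket q t _).
  by rewrite /bump /=; move: (ltn_ord j); lia.
rewrite prod_columns card_ord.
have gE (T : {set 'I_N * 'I_N}) : \prod_(s in T) g s =
    if [forall s in T, shaded s]
    then (-1) ^+ #|T| * (q ^+ below T * t ^+ nrow T) else 0.
  case: ifPn => [/forall_inP Tsh|]; last first.
    rewrite negb_forall_in => /exists_inP[s sT sh].
    by rewrite (bigD1 s) //= /g (negbTE sh) mul0r.
  rewrite (eq_bigr (fun s => -1 * (q ^+ squares_below s * t ^+ (s.1 != 1%N :> nat)))).
    rewrite !big_split /= prodr_const !prodrXr; congr (_ * (_ * t ^+ _)).
    rewrite /nrow -sum1_card big_mkcond [RHS]big_mkcond /=.
    by apply: eq_bigr => s _; rewrite inE; case: (s \in T); case: (_ == _).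
  by move=> s sT; rewrite /g Tsh // mulN1r.
rewrite (eq_bigr _ (fun T _ => congr1 _ (gE T))) big_mkord.
have le_N (T : {set 'I_N * 'I_N}) : column_free T -> (#|T| <= N)%N.
  by move/column_free_card; rewrite card_ord.
(* The number of columns without a rook is the exponent of [x]; grouping by it collects the
   coefficient of each power. *)
pose uncovered (T : {set 'I_N * 'I_N}) : 'I_N.+1 := inord (N - #|T|).
rewrite (partition_big uncovered predT) //=.
apply: eq_bigr => k _; rewrite /qt_stirling1 ltnNge -ltnS ltn_ord /=.
rewrite mulr_sumr mulr_suml [LHS]big_mkcond [RHS]big_mkcond /=.
apply: eq_bigr => T _; rewrite inE -/(column_free T) -(inj_eq val_inj).
case: (boolP (column_free T)) => Tfree; rewrite ?andbF //= inordK ?ltnS ?leq_subr //.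
have -> : (N - #|T| == k)%N = (#|T| == N - k)%N.
  by move: (le_N _ Tfree) (ltn_ord k); lia.
case: eqP => //= Tk; case: ifP => //= _; last by rewrite mulr0.
rewrite Tk mulrC subKn // -ltnS; exact: ltn_ord.
Qed.

(** * Allowable words *)

Section AllowableWords.

Local Open Scope nat_scope.

Lemma prefix_max_rcons w a i :
  i <= size w -> prefix_max (rcons w a) i = prefix_max w i.
Proof.
move=> iw; rewrite /prefix_max -cats1 take_cat.
case: ltnP => // wi; have -> : i = size w by lia.
by rewrite subnn take0 cats0 take_size.
Qed.

Lemma prefix_max_size w : prefix_max w (size w) = \max_(a <- w) a.
Proof. by rewrite /prefix_max take_size. Qed.

Lemma letter_rcons w a i : 0 < i <= size w -> letter (rcons w a) i = letter w i.
Proof. by case: i => // i /= iw; rewrite /letter nth_rcons /= iw. Qed.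

Lemma letter_rcons_last w a : letter (rcons w a) (size w).+1 = a.
Proof. by rewrite /letter nth_rcons /= ltnn eqxx. Qed.

Lemma iota2S n : 0 < n -> iota 2 n = rcons (iota 2 n.-1) n.+1.
Proof.
by case: n => // n _; rewrite -[iota 2 n.+1]/(iota 2 (1 + n)) addnC iotaD cats1 add2n.
Qed.

(** Testing the truncated word against its own maximum treats a repeated letter and a new maximum by
    one formula. *)
Lemma is_RG_word_rcons n k w a :
  0 < n -> is_RG_word n.+1 k (rcons w a) =
    [&& is_RG_word n (\max_(b <- w) b) w, 0 < a <= (\max_(b <- w) b).+1
      & maxn (\max_(b <- w) b) a == k].
Proof.
move=> n_gt0; rewrite /is_RG_word size_rcons eqSS.
case: eqP => //= sw; rewrite -sw in n_gt0 *.
rewrite all_rcons letter_rcons ?n_gt0 // prefix_max_size eqxx andbT.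
rewrite iota2S // all_rcons.
have -> : prefix_max (rcons w a) (size w).+1 = maxn (\max_(b <- w) b) a.
  by rewrite -(size_rcons w a) prefix_max_size -cats1 big_cat big_seq1.
have -> : all (fun i => letter (rcons w a) i <= prefix_max (rcons w a) i.-1 + 1)
              (iota 2 (size w).-1)
        = all (fun i => letter w i <= prefix_max w i.-1 + 1) (iota 2 (size w).-1).
  apply: eq_in_all => i; rewrite mem_iota => i_n.
  by rewrite letter_rcons ?prefix_max_rcons //; lia.
rewrite letter_rcons_last /= prefix_max_rcons // prefix_max_size addn1.
case: (all (leq 1) w); case: (letter w 1 == 1); case: (all _ _);
  rewrite /= ?andbF ?andbT //.
by rewrite -?andbA.
Qed.

(** Each letter exceeds the previous maximum by at most one, so no value up to the maximum is
    skipped. *)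
Lemma RG_word_letters n w (b : nat) :
  is_RG_word n (\max_(a <- w) a) w -> (b \in w) = (0 < b <= \max_(a <- w) a).
Proof.
case: n => [|n]; first by case: w => // /andP[].
elim: n w => [|n IH] w.
  case: w => [/andP[]//|a [|? ?] /and5P[//= _ _ /eqP]]; rewrite /letter /= => -> _ _.
  by rewrite inE big_seq1; lia.
case/lastP: w => [/andP[]//|w a]; rewrite is_RG_word_rcons // => /and3P[/IH wE a_le _].
rewrite mem_rcons inE wE -cats1 big_cat big_seq1 /=; lia.
Qed.

Definition is_allowable n k w := is_RG_word n k w && even_letters_once w.

Lemma is_allowable_rcons n k w a :
  0 < n -> is_allowable n.+1 k.+1 (rcons w a) =
    (a == k.+1) && is_allowable n k w ||
    [&& a <= k.+1, odd a & is_allowable n k.+1 w].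
Proof.
move=> n_gt0; rewrite /is_allowable is_RG_word_rcons //.
set m := \max_(b <- w) b.
have RGmax j : is_RG_word n j w = is_RG_word n m w && (m == j).
  rewrite /is_RG_word; case: (size w =P n) => //= <-.
  by rewrite prefix_max_size eqxx -!andbA.
rewrite (RGmax k) (RGmax k.+1).
case RGw: (is_RG_word n m w) => /=; last by rewrite ?andbF.
have wE b := RG_word_letters b RGw.
case: (boolP (0 < a <= m.+1)) => /= a_m; last first.
  by lia.
have evE : even_letters_once (rcons w a) =
    ((a == m.+1) || odd a) && even_letters_once w.
  rewrite /even_letters_once all_rcons -cats1 count_cat /= eqxx addn0 addn1 eqSS.
  (* An even [a] may be appended only if it is absent from [w]; since [w] uses all of [1..m], this
     forces [a = m.+1]. *)
  rewrite -[_ == 0]negbK -lt0n -has_count has_pred1 wE -/m.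
  case: (boolP (odd a)) => /= [oa|ea].
    rewrite orbT; apply: eq_in_all => b bw; case: (boolP (odd b)) => //= eb.
    rewrite count_cat /= (_ : (a == b) = false) ?addn0 //.
    by apply: contraNF eb => /eqP <-.
  rewrite orbF; have -> : ~~ (0 < a <= m) = (a == m.+1) by lia.
  case: eqP => //= am; apply: eq_in_all => b bw.
  rewrite count_cat /= (_ : (a == b) = false) ?addn0 //.
  by move: bw; rewrite wE -/m; lia.
by rewrite evE; case: even_letters_once; lia.
Qed.

Lemma is_allowable0 n w : is_allowable n 0 w = false.
Proof.
apply/negP => /andP[RGw _]; case: w RGw => [|a w]; first by case/and5P.
move=> /and5P[/eqP <- /= /andP[a0 _] _ _].
by rewrite (prefix_max_size (a :: w)) big_cons; lia.
Qed.

Lemma is_allowable1 k w : is_allowable 1 k w = (k == 1) && (w == [:: 1]).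
Proof.
rewrite /is_allowable /is_RG_word.
case: w => [|a [|b w]]; rewrite ?andbF //=; last by rewrite eqseq_cons !andbF.
rewrite /letter /prefix_max /even_letters_once /= big_seq1 eqseq_cons andbT.
case: (a =P 1) => [->|_] /=; last by rewrite ?andbF.
by rewrite eq_sym !andbT.
Qed.

Definition odd_letters k := [seq a <- iota 1 k | odd a].
Arguments odd_letters : simpl never.

Lemma mem_odd_letters k a : (a \in odd_letters k) = (a <= k) && odd a.
Proof. by rewrite mem_filter mem_iota; lia. Qed.

(* The empty word is not an RG-word; it starts the recursion, in agreement with
   [S[0, 0] = 1]. *)
Fixpoint allowable_words n k : seq (seq nat) :=
  match n, k with
  | 0, 0 => [:: [::]]
  | n'.+1, k'.+1 => [seq rcons w k | w <- allowable_words n' k'] ++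
      [seq rcons w a | w <- allowable_words n' k, a <- odd_letters k]
  | _, _ => [::]
  end.

Lemma allowable_wordsS n k :
  allowable_words n.+1 k.+1 =
    [seq rcons w k.+1 | w <- allowable_words n k] ++
    [seq rcons w a | w <- allowable_words n k.+1,
                     a <- odd_letters k.+1].
Proof. by []. Qed.

Lemma mem_allowable_words n k w :
  (w \in allowable_words n.+1 k) = is_allowable n.+1 k w.
Proof.
elim: n k w => [|n IH] [|k] w; rewrite ?is_allowable0 //.
  by rewrite is_allowable1; case: k => [|k] //=; rewrite inE.
case/lastP: w => [|w a].
  rewrite [RHS]/is_allowable [RHS]/=; apply/negP.
  rewrite mem_cat => /orP[/mapP[v _]|/allpairsP[v [_ _]]] /(congr1 size);
    by rewrite size_rcons.
rewrite is_allowable_rcons // -!IH allowable_wordsS mem_cat.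
congr (_ || _); apply/idP/idP.
- by case/mapP => v v_in /rcons_inj[-> ->]; rewrite eqxx.
- by case/andP => /eqP -> w_in; apply: map_f.
- case/allpairsP => [[v b] [/= v_in b_in /rcons_inj[-> ->]]]; rewrite v_in andbT.
  by rewrite -mem_odd_letters.
case/and3P => a_k odd_a w_in; apply: allpairs_f => //.
by rewrite mem_odd_letters a_k.
Qed.

Lemma size_allowable_words n k w : w \in allowable_words n k -> size w = n.
Proof.
case: n => [|n]; first by case: k => //; rewrite inE => /eqP ->.
by rewrite mem_allowable_words => /andP[/andP[/eqP]].
Qed.

Lemma max_allowable_words n k w :
  w \in allowable_words n k -> \max_(b <- w) b = k.
Proof.
case: n => [|n]; first by case: k => //; rewrite inE => /eqP ->; rewrite big_nil.
move=> w_in; rewrite -prefix_max_size (size_allowable_words w_in).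
by move: w_in; rewrite mem_allowable_words => /andP[/and5P[_ _ _ _ /eqP]].
Qed.

Lemma allowable_words_gt n k : n < k -> allowable_words n k = [::].
Proof.
elim: n k => [|n IH] [|k] // lt_nk.
by rewrite allowable_wordsS !IH // (ltn_trans _ lt_nk).
Qed.

Lemma uniq_allowable_words n k : uniq (allowable_words n k).
Proof.
elim: n k => [|n IH] [|k] //; rewrite allowable_wordsS cat_uniq.
apply/and3P; split.
- by rewrite map_inj_uniq //; apply: rcons_injl.
(* The two families are disjoint: their truncated words have maxima [k.+1] and [k]. *)
- apply/hasPn => _ /allpairsP[[v a] /= [v_in _ ->]]; apply/mapP => -[v'].
  move=> v'_in /rcons_inj[vv' _].
  move: (max_allowable_words v_in) (max_allowable_words v'_in).
  by rewrite vv' => ->; lia.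
apply: allpairs_uniq => //; first by rewrite filter_uniq ?iota_uniq.
by move=> [v a] [v' a'] _ _ /= /rcons_inj[-> ->].
Qed.

Lemma statA_rcons w a : 0 < size w ->
  statA (rcons w a) = statA w + (if a <= \max_(b <- w) b then a - 1 else 0).
Proof.
move=> w_gt0; rewrite /statA size_rcons big_nat_recr //=; congr (_ + _).
  rewrite !big_nat; apply: eq_bigr => i i_w.
  by rewrite letter_rcons ?prefix_max_rcons //; lia.
by rewrite letter_rcons_last prefix_max_rcons // prefix_max_size.
Qed.

Lemma statB_rcons w a : 0 < size w ->
  statB (rcons w a) = statB w + (a < \max_(b <- w) b).
Proof.
move=> w_gt0; rewrite /statB size_rcons /= iota2S //.
rewrite -[rcons (iota _ _) _]cats1 count_cat /= addn0.
congr (_ + _).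
  apply: eq_in_count => i; rewrite mem_iota => i_w.
  by rewrite letter_rcons ?prefix_max_rcons //; lia.
by rewrite letter_rcons_last /= prefix_max_rcons // prefix_max_size.
Qed.

End AllowableWords.

(** * The recurrence for [qt_stirling2] and the expansion of powers *)

Section Stirling2.
Variables (R : comNzRingType) (q t : R).

Definition word_weight w : R := q ^+ statA w * t ^+ statB w.

(** Tuples are traded for the recursive list, from which the recurrence can be read off; both
    enumerate the same words without repetition. *)
Lemma qt_stirling2E n k :
  qt_stirling2 q t n k = \sum_(w <- allowable_words n k) word_weight w.
Proof.
rewrite /qt_stirling2; case: n k => [|n] [|k] /=.
- by rewrite big_seq1 /word_weight /statA /statB big_geq // mulr1.
- by rewrite big_nil.
- by rewrite big_nil.
rewrite -/(allowable_words n.+1 k.+1).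
case: ltnP => [lt_nk|_]; first by rewrite allowable_words_gt // big_nil.
rewrite -big_enum -(big_map (@nat_word n.+1 k.+1) predT word_weight).
apply: perm_big; apply: uniq_perm; last 1 first.
- move=> w; apply/mapP/idP => [[v]|w_in].
    by rewrite mem_enum !inE => v_ok ->; rewrite mem_allowable_words.
  (* All letters of [w] are at most its maximum [k.+1], so [inord] preserves them. *)
  have sw : size [seq inord a : 'I_k.+2 | a <- w] == n.+1.
    by rewrite size_map (size_allowable_words w_in).
  have wE : w = nat_word (Tuple sw).
    rewrite /nat_word /= -map_comp -[LHS]map_id; apply/eq_in_map => a a_w /=.
    by rewrite inordK // ltnS -(max_allowable_words w_in) (leq_bigmax_seq a).
  exists (Tuple sw) => //.
  by rewrite mem_enum !inE -wE -/(is_allowable _ _ _) -mem_allowable_words.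
- rewrite map_inj_uniq ?enum_uniq // => v v' /(inj_map val_inj) vv'.
  exact: val_inj.
exact: uniq_allowable_words.
Qed.

(** A final new maximum changes neither statistic; a final odd letter [i.+1] under the maximum
    [k.+1] multiplies the weight by the summand of index [i] in [qt_bracketE]. *)
Lemma qt_stirling2_rec n k :
  qt_stirling2 q t n.+1 k.+1 =
    qt_stirling2 q t n k + qt_bracket q t k.+1 * qt_stirling2 q t n k.+1.
Proof.
rewrite !qt_stirling2E allowable_wordsS big_cat big_map big_allpairs_dep.
(* The statistics start at position 2, so [statA_rcons] and [statB_rcons] need a nonempty word;
   length 0 is computed directly. *)
case: n => [|n].
  by case: k => [|k]; rewrite !big_nil mulr0 ?big_seq1 // /word_weight /statA !big_geq.
congr (_ + _).
  rewrite !big_seq; apply: eq_bigr => w w_in.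
  rewrite /word_weight statA_rcons ?statB_rcons ?(size_allowable_words w_in) //.
  by rewrite (max_allowable_words w_in) ltnn ltnNge leqnSn !addn0.
rewrite mulr_sumr !big_seq; apply: eq_bigr => w w_in.
rewrite qt_bracketE mulr_suml /odd_letters big_filter.
rewrite -[iota 1 k.+1]/(index_iota 1 k.+2) big_add1 big_mkord.
apply: eq_bigr => i _.
rewrite /word_weight statA_rcons ?statB_rcons ?(size_allowable_words w_in) //.
rewrite (max_allowable_words w_in) ltn_ord subn1 /= ltn_neqAle ltn_ord andbT !exprD.
by rewrite mulrACA mulrC.
Qed.

Lemma expr_qt_stirling2 x n :
  x ^+ n = \sum_(0 <= k < n.+1) qt_stirling2 q t n k * qt_falling q t x k.
Proof.
have S_gt m : qt_stirling2 q t m m.+1 = 0 by rewrite /qt_stirling2 ltnSn.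
elim: n => [|n IH]; first by rewrite big_nat1 /qt_falling big_ord0 mulr1.
rewrite big_nat_recl // [qt_stirling2 _ _ n.+1 0]/qt_stirling2 /= mul0r add0r.
under eq_bigr do rewrite qt_stirling2_rec mulrDl.
rewrite big_split /= exprSr IH mulr_suml.
pose H k := qt_bracket q t k * qt_stirling2 q t n k * qt_falling q t x k.
rewrite -/(\sum_(0 <= k < n.+1) H k.+1).
(* The shift costs nothing: [H n.+1] vanishes by [S_gt], and [H 0] because the bracket of 0 is 0. *)
have -> : \sum_(0 <= k < n.+1) H k.+1 = \sum_(0 <= k < n.+1) H k.
  rewrite [RHS]big_nat_recl // [LHS]big_nat_recr //= {2}/H S_gt mulr0 mul0r addr0.
  by rewrite {2}/H /qt_bracket /= big_ord0 !mul0r add0r.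
rewrite -big_split; apply: eq_bigr => k _.
by rewrite /H /qt_falling big_ord_recr /=; ring.
Qed.

End Stirling2.

Unset Implicit Arguments.

Theorem theorem9p3 (n : nat) :
  qt_falling Xq Xt Xx n
    = \sum_(0 <= k < n.+1) qt_stirling1 Xq Xt n k * Xx ^+ k
  /\
  Xx ^+ n
    = \sum_(0 <= k < n.+1) qt_stirling2 Xq Xt n k * qt_falling Xq Xt Xx k.
Proof. by split; [apply: qt_falling_stirling1 | apply: expr_qt_stirling2]. Qed.
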